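(* There is an absolute constant $C>0$ such that for every positive integer $r$ and every sufficiently large $n$ (depending on $r$), $F_r(n)\le Cn/r$; that is, $F_r(n)=O(n/r)$.
   Context: For a positive integer $n$, $[n]=\{1,\dots,n\}$ and $[n]^{(2)}$ is the set of $2$-element subsets of $[n]$. $\mathcal{C}_{n;r}$ is the set of all maps $c:[n]^{(2)}\to[r]$. For such $c$, a twin of size $\ell$ is a pair of disjoint sets $I=\{i_1<\dots<i_\ell\}$, $J=\{j_1<\dots<j_\ell\}\subset[n]$ with $c(\{i_t,i_{t+1}\})=c(\{j_t,j_{t+1}\})$ for all $t=1,\dots,\ell-1$; $f(c)$ is the maximum size of a twin of $c$, and $F_r(n)=\min_{c\in\mathcal{C}_{n;r}}f(c)$. *)

(* Defs.v *)
From mathcomp Require Import all_boot.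

Set Implicit Arguments.
Unset Strict Implicit.
Unset Printing Implicit Defensive.

(* The ordered set {1 < ... < n} is represented by 'I_n, and the set of colours
   {1, ..., r} by 'I_r. *)
Definition pair2 (n : nat) : finType := {e : {set 'I_n} | #|e| == 2}.

Definition coloring (n r : nat) : finType := {ffun pair2 n -> 'I_r}.

(* c({x, y}), as an option: [None] only arises for x = y, which never happens
   for consecutive elements of a set (see [color_pair2], [insub_pair2]). *)
Definition color (n r : nat) (c : coloring n r) (x y : 'I_n) : option 'I_r :=
  omap c (insub [set x; y]).

Lemma color_pair2 (n r : nat) (c : coloring n r) (x y : 'I_n) (e : pair2 n) :
  val e = [set x; y] -> color c x y = Some (c e).
Proof. by rewrite /color => <-; rewrite valK. Qed.

Lemma insub_pair2 (n : nat) (x y : 'I_n) :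
  x != y -> exists e : pair2 n, val e = [set x; y].
Proof.
move=> xy; have h : #|[set x; y]| == 2 by rewrite cards2 xy.
by exists (Sub [set x; y] h).
Qed.

(* [enum_val s], s = 0, ..., #|A| - 1, lists A in increasing order. *)
Lemma enum_val_increasing (n : nat) (A : {set 'I_n}) (s t : 'I_#|A|) :
  s < t -> enum_val s < enum_val t.
Proof.
move=> st; pose x0 := enum_val s.
have srt : sorted ltn (map val (enum A)).
  apply: (subseq_sorted ltn_trans (s2 := map val (enum 'I_n))).
    by rewrite map_subseq // enumT /enum_mem filter_subseq.
  by rewrite val_enum_ord iota_ltn_sorted.
have szE : size (map val (enum A)) = #|A| by rewrite size_map -cardE.
have := sorted_ltn_nth ltn_trans (val x0) srt _ _ _ _ st.
rewrite !inE !szE !ltn_ord => /(_ isT isT).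
by rewrite !(nth_map x0) -?cardE ?ltn_ord // -!enum_val_nth.
Qed.

(* Positions are counted from 0; (s, s') and (t, t') are two pairs of
   consecutive positions that start at the same place in I and in J. *)
Definition is_twin (n r : nat) (c : coloring n r) (l : nat)
    (I J : {set 'I_n}) : bool :=
  [&& #|I| == l, #|J| == l, [disjoint I & J] &
      [forall s : 'I_#|I|, forall s' : 'I_#|I|,
       forall t : 'I_#|J|, forall t' : 'I_#|J|,
         [&& val t == val s, val s' == (val s).+1 & val t' == (val t).+1] ==>
         (color c (enum_val s) (enum_val s') ==
          color c (enum_val t) (enum_val t'))]].

Definition has_twin (n r : nat) (c : coloring n r) (l : nat) : bool :=
  [exists I : {set 'I_n}, exists J : {set 'I_n}, is_twin c l I J].

(* A twin has size at most n, so the range of l loses nothing; the maximum is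
   attained by [max_twinP]. *)
Definition max_twin (n r : nat) (c : coloring n r) : nat :=
  \max_(l < n.+1 | has_twin c l) l.

Lemma max_twinP (n r : nat) (c : coloring n r) :
  has_twin c (max_twin c) /\ forall l, has_twin c l -> l <= max_twin c.
Proof.
have h0 : has_twin c (ord0 : 'I_n.+1).
  apply/existsP; exists set0; apply/existsP; exists set0.
  apply/and4P; split; rewrite ?cards0 -?setI_eq0 ?set0I //.
  by apply/forallP => -[s hs]; exfalso; move: hs; rewrite cards0.
split.
  rewrite /max_twin (bigmax_eq_arg (ord0 : 'I_n.+1)) //.
  by case: arg_maxnP.
move=> l hl; have ln : l < n.+1.
  case/existsP: (hl) => I /existsP[J /and4P[/eqP <- _ _ _]].
  by rewrite ltnS -[X in _ <= X]card_ord max_card.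
exact: (leq_bigmax_cond (Ordinal ln)).
Qed.

(* The default value n is an upper bound of [max_twin], so for r > 0 this is
   the minimum over all colourings ([min_max_twinP]). *)
Definition min_max_twin (r n : nat) : nat :=
  \big[minn/n]_(c : coloring n r) max_twin c.

Lemma min_max_twinP (r n : nat) : 0 < r ->
  (exists c : coloring n r, max_twin c = min_max_twin r n) /\
  forall c : coloring n r, min_max_twin r n <= max_twin c.
Proof.
move=> r0; pose c0 : coloring n r := [ffun=> Ordinal r0].
have mle (c : coloring n r) : max_twin c <= n.
  by apply/bigmax_leqP => l _; rewrite -ltnS.
have lb (c : coloring n r) : min_max_twin r n <= max_twin c.
  rewrite /min_max_twin; elim: index_enum (mem_index_enum c) => //= d s IHs.
  rewrite inE big_cons; case/predU1P => [<-|/IHs h]; first exact: geq_minl.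
  exact: leq_trans (geq_minr _ _) h.
split=> //.
have [//|e] : (exists c : coloring n r, max_twin c = min_max_twin r n)
    \/ min_max_twin r n = n.
  rewrite /min_max_twin; elim/big_ind: _ => [|x y hx hy|c _].
  - by right.
  - by rewrite /minn; case: ifP.
  - by left; exists c.
by exists c0; apply/eqP; rewrite eqn_leq lb e mle.
Qed.

(* Main.v *)
Require Import Defs.
From mathcomp Require Import all_boot all_order all_algebra.
From mathcomp Require Import all_field zify ring.
From mathcomp Require Import reals.
Import Order.TTheory GRing.Theory Num.Theory.

Set Implicit Arguments.
Unset Strict Implicit.
Unset Printing Implicit Defensive.

(** Let F be a finite field with p = 2^k elements and 2p^2 <= r < 8p^2. Cut
   [n] into N ~ n/p^2 blocks of p^2 consecutive vertices. Half of the colours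
   are kept for the edges inside a block, half for the cross edges, so in a
   twin the steps of I and J cross simultaneously; at most N steps cross. The
   colour of an edge only depends on its left endpoint: inside a block it is the
   label of that endpoint, a bijection from the block onto F^2, and on cross
   edges it is w1 (B) for the block B of that endpoint. The labelling of B is one
   of p^2 possible ones, chosen by w2 (B); w1 and w2 are random words over F^2.
   On a run of non-crossing steps I and J stay in distinct blocks B and B' (a
   common block would force a common vertex), and the run has length at most 4p
   if w2 (B) <> w2 (B') and p^2 otherwise. A union bound on w1 leaves O(N/p) runs,
   a union bound on (w1, w2) leaves O(N/p^2) runs with w2 (B) = w2 (B'); so the
   twin has size O(N) = O(n/r). *)

(** * Binomial estimates for the union bounds *)

(** Both sides compare with 2k (2k - 1) ... (k + 1) = C(2k, k) k!, where C(2k, k) <= 4^k. *)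
Lemma expnn_le_fact k : k ^ k <= 4 ^ k * k`!.
Proof.
have h1 : k ^ k <= (k + k) ^_ k.
  rewrite ffact_prod -[X in _ ^ X]card_ord -prod_nat_const.
  by apply: leq_prod => i _; have := ltn_ord i; lia.
apply: (leq_trans h1); rewrite -bin_ffact leq_mul2r; apply/orP; right.
rewrite -[4]/(2 ^ 2) -expnM mul2n -addnn -[2]/(1 + 1) expnDn.
have hk : k < (k + k).+1 by lia.
rewrite (bigD1 (Ordinal hk)) //= !exp1n !muln1.
exact: leq_addr.
Qed.

(** C(N, k) <= N^k / k! <= (4N / k)^k <= (q / 2)^k. Here C(N, k)^2 will count pairs of increasing
    k-tuples of positions. *)
Lemma bin_sqr_lt N k q : 0 < N -> 0 < k -> 8 * N <= k * q ->
  2 * 'C(N, k) ^ 2 < (q ^ 2) ^ k.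
Proof.
move=> N0 k0 hkq.
have q0 : 0 < q by nia.
have h1 : 'C(N, k) * k`! <= N ^ k.
  rewrite bin_ffact ffact_prod -[X in _ ^ X]card_ord -prod_nat_const.
  by apply: leq_prod => i _; exact: leq_subr.
have h2 : 'C(N, k) * 2 ^ k <= q ^ k.
  have h4 : 0 < (4 * N) ^ k by rewrite expn_gt0 muln_gt0 N0.
  rewrite -(leq_pmul2r h4) -mulnA -expnMn.
  have -> : 2 * (4 * N) = 8 * N by lia.
  apply: (@leq_trans ('C(N, k) * (k * q) ^ k)).
    by rewrite leq_mul2l leq_exp2r // hkq orbT.
  rewrite expnMn mulnA [leqRHS]mulnC leq_mul2r; apply/orP; right.
  apply: (@leq_trans ('C(N, k) * (4 ^ k * k`!))).
    by rewrite leq_mul2l expnn_le_fact orbT.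
  by rewrite mulnCA expnMn leq_mul2l h1 orbT.
have h3 : 2 <= 2 ^ k by rewrite -[X in X <= _](expn1 2) leq_exp2l.
have h4 : 'C(N, k) * 2 <= q ^ k by apply: leq_trans h2; rewrite leq_mul2l h3 orbT.
have h5 : 0 < q ^ k by rewrite expn_gt0 q0.
rewrite expnAC -(leq_exp2r _ _ (isT : 0 < 2)) expnMn in h4 *.
have : 0 < (q ^ k) ^ 2 by rewrite expn_gt0 h5.
move: h4; move: ('C(N, k) ^ 2) ((q ^ k) ^ 2) => B X; lia.
Qed.

(** * Random words and their repeated letters *)

Section RandomWords.
Variables (A : finType) (N : nat).

Let incr k := [set t : k.-tuple 'I_N | sorted ltn (map val t)].

(** Requiring distinct positions inside the set lets the union bound range over all pairs of
    increasing tuples: pairs that meet contribute the empty set. *)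
Let agree k (st : k.-tuple 'I_N * k.-tuple 'I_N) : {set {ffun 'I_N -> A}} :=
  [set f : {ffun 'I_N -> A} |
    [forall i, (tnth st.1 i != tnth st.2 i) && (f (tnth st.1 i) == f (tnth st.2 i))]].

Lemma tnth_incr k (t : k.-tuple 'I_N) (i j : 'I_k) :
  t \in incr k -> i < j -> tnth t i < tnth t j.
Proof.
rewrite inE => srt ij.
have := sorted_ltn_nth ltn_trans 0 srt i j.
rewrite !inE !size_map !size_tuple !ltn_ord => /(_ isT isT ij).
by rewrite !(nth_map (tnth t i)) ?size_tuple ?ltn_ord // -!tnth_nth.
Qed.

(* The value of such an f at max (s_i, t_i) is determined by its value at
   min (s_i, t_i), and these maxima are pairwise distinct. *)
Lemma card_agree k (s t : k.-tuple 'I_N) :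
  s \in incr k -> t \in incr k -> 0 < #|A| ->
  #|agree (s, t)| <= #|A| ^ (N - k).
Proof.
move=> hs ht /card_gt0P[a0 _].
pose mx i := if tnth s i < tnth t i then tnth t i else tnth s i.
have mxlt (i j : 'I_k) : i < j -> mx i < mx j.
  move=> ij; have := tnth_incr hs ij; have := tnth_incr ht ij.
  by rewrite /mx; do 2 case: ifP; lia.
have mxinj : injective mx.
  move=> i j eij; apply: ord_inj; case: (ltngtP i j) => // /mxlt.
    by rewrite eij ltnn.
  by rewrite eij ltnn.
pose M := [set mx i | i in 'I_k].
have cM : #|M| = k by rewrite card_imset // card_ord.
pose res (f : {ffun 'I_N -> A}) := [ffun x => if x \in M then a0 else f x].
have inj : {in agree (s, t) &, injective res}.
  move=> f g; rewrite !inE => /forallP hf /forallP hg efg; apply/ffunP => x.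
  have [m] := ubnP (val x); elim: m x => // m IH x; rewrite ltnS => xm.
  have [/imsetP[i _ ex]|xM] := boolP (x \in M); last first.
    by move/ffunP: efg => /(_ x); rewrite !ffunE (negPf xM).
  move: (hf i) (hg i) => /= /andP[ne /eqP ef] /andP[_ /eqP eg].
  rewrite -(inj_eq val_inj) in ne.
  move: ex; rewrite /mx; case: ifP => lt ex; rewrite ex in xm *.
    by rewrite -ef -eg; apply: IH; exact: leq_trans lt xm.
  rewrite ef eg; apply: IH; apply: leq_trans xm; move: ne lt => /=; lia.
rewrite -(card_in_imset inj).
have -> : N - k = #|~: M| by rewrite [RHS]cardsCs setCK card_ord cM.
rewrite -(@card_pffun_on _ _ a0 (mem (~: M)) (mem A)).
apply: subset_leq_card; apply/subsetP => _ /imsetP[f _ ->].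
apply/pffun_onP; split => //.
by apply/supportP => x; rewrite !inE negbK ffunE => ->.
Qed.

Lemma card_bigcup_le (I T : finType) (P : {set I}) (B : I -> {set T}) d :
  (forall i, i \in P -> #|B i| <= d) -> #|\bigcup_(i in P) B i| <= #|P| * d.
Proof.
move=> h; rewrite -sum_nat_const.
elim/big_ind2: _ => [|X x Y y hX hY|i /h//]; first by rewrite cards0.
by apply: leq_trans (leq_card_setU _ _) (leq_add _ _).
Qed.

Let pairs k := setX (incr k) (incr k).

Lemma card_pairs k : #|pairs k| = 'C(N, k) ^ 2.
Proof. by rewrite cardsX /incr card_ltn_sorted_tuples mulnn. Qed.

Lemma bin_sqr_mul_lt k m : 0 < m -> 2 * 'C(N, k) ^ 2 < m ^ k ->
  2 * ('C(N, k) ^ 2 * m ^ (N - k)) < m ^ N.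
Proof.
move=> m0 h; have [kN|Nk] := leqP k N; last first.
  by rewrite bin_small // expn_gt0 m0.
by rewrite -[X in _ < _ ^ X](subnKC kN) expnD mulnA ltn_pmul2r // expn_gt0 m0.
Qed.

(* Two independent uniform words work: each of the two failures has probability
   less than 1/2. *)
Lemma exists_words k1 k2 : 0 < #|A| ->
  2 * 'C(N, k1) ^ 2 < #|A| ^ k1 -> 2 * 'C(N, k2) ^ 2 < (#|A| ^ 2) ^ k2 ->
  exists w1 w2 : nat -> A, forall (T : seq nat) (f g : nat -> nat),
    sorted ltn (map f T) -> sorted ltn (map g T) ->
    (forall t, t \in T -> [/\ f t < N, g t < N, f t <> g t & w1 (f t) = w1 (g t)]) ->
    size T < k1 /\
    ((forall t, t \in T -> w2 (f t) = w2 (g t)) -> size T < k2).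
Proof.
move=> A0 hk1 hk2.
pose bad1 := \bigcup_(st in pairs k1) setX (agree st) [set: {ffun 'I_N -> A}].
pose bad2 := \bigcup_(st in pairs k2) setX (agree st) (agree st).
have cA : #|{ffun 'I_N -> A}| = #|A| ^ N by rewrite card_ffun card_ord.
have b1 : 2 * #|bad1| < #|A| ^ N * #|A| ^ N.
  have h : #|bad1| <= #|pairs k1| * (#|A| ^ (N - k1) * #|A| ^ N).
    apply: card_bigcup_le => -[s t] /setXP[hs ht].
    by rewrite cardsX cardsT cA leq_mul2r card_agree ?orbT.
  apply: leq_ltn_trans (_ : 2 * (#|pairs k1| * (#|A| ^ (N - k1) * #|A| ^ N)) < _).
    by rewrite leq_mul2l.
  rewrite card_pairs (mulnA (_ ^ 2)) mulnA ltn_pmul2r ?expn_gt0 ?A0 //.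
  exact: bin_sqr_mul_lt.
have b2 : 2 * #|bad2| < #|A| ^ N * #|A| ^ N.
  have h : #|bad2| <= #|pairs k2| * (#|A| ^ 2) ^ (N - k2).
    apply: card_bigcup_le => -[s t] /setXP[hs ht].
    by rewrite cardsX expnAC -mulnn leq_mul // card_agree.
  apply: leq_ltn_trans (_ : 2 * (#|pairs k2| * (#|A| ^ 2) ^ (N - k2)) < _).
    by rewrite leq_mul2l.
  rewrite card_pairs mulnn (expnAC _ N).
  by apply: bin_sqr_mul_lt; rewrite // expn_gt0 A0.
have [[w1 w2]] : exists w, w \in ~: (bad1 :|: bad2).
  apply/card_gt0P; rewrite cardsCs setCK subn_gt0 card_prod cA.
  apply: leq_ltn_trans (leq_card_setU _ _) _; lia.
rewrite !inE negb_or => /andP[nb1 nb2].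
(* For N = 0 the list T is empty, and k1 and k2 are positive because 2 < 1 fails. *)
case: (posnP N) => [N0|Npos].
  have [a0 _] := card_gt0P A0.
  exists (fun=> a0), (fun=> a0) => T f g _ _ h.
  case: T h => [_|t T /(_ t (mem_head _ _))[]]; last by rewrite N0.
  move: hk1 hk2; rewrite N0; case: k1 {nb1 bad1 b1} => //; case: k2 {nb2 bad2 b2} => //.
pose nt (x : nat) : 'I_N := insubd (Ordinal Npos) x.
have ntK x : x < N -> val (nt x) = x by move=> h; rewrite val_insubd h.
exists (fun x => w1 (nt x)), (fun x => w2 (nt x)) => T f g srtf srtg h.
(* The first k entries of a list that is too long give a pair of tuples witnessing a bad event. *)
have tup k : k <= size T -> exists2 st, st \in pairs k &
    forall i : 'I_k, exists2 t, t \in T & tnth st.1 i = nt (f t) /\ tnth st.2 i = nt (g t).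
  move=> kT.
  have sz (F : nat -> nat) : size (map (nt \o F) (take k T)) == k.
    by rewrite size_map size_takel.
  exists (Tuple (sz f), Tuple (sz g)) => [|i].
    have aux (F : nat -> nat) : (forall t, t \in T -> F t < N) ->
        sorted ltn (map F T) -> Tuple (sz F) \in incr k.
      move=> hF srt; rewrite inE /= -map_comp.
      have -> : [seq (val \o (nt \o F)) i | i <- take k T] = take k (map F T).
        by rewrite -map_take; apply/eq_in_map => t /mem_take/hF /= /ntK.
      exact: take_sorted.
    by apply/setXP; split; apply: aux => // t /h[].
  have iT : i < size (take k T) by rewrite size_takel.
  exists (nth 0 (take k T) i); first by apply: mem_take; exact: mem_nth.
  by rewrite !(tnth_nth (Ordinal Npos)) /= !(nth_map 0).
have agr k (w : {ffun 'I_N -> A}) st :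
    (forall i : 'I_k, exists2 t, t \in T & tnth st.1 i = nt (f t) /\ tnth st.2 i = nt (g t)) ->
    (forall t, t \in T -> w (nt (f t)) = w (nt (g t))) -> w \in agree st.
  move=> hst hw; rewrite inE; apply/forallP => i; have [t tT [-> ->]] := hst i.
  rewrite hw // eqxx andbT -(inj_eq val_inj).
  by have [fN gN /eqP ne _] := h t tT; rewrite !ntK.
have w1T t : t \in T -> w1 (nt (f t)) = w1 (nt (g t)) by case/h.
split=> [|w2T]; rewrite ltnNge; apply/negP => /tup[st sti hst].
  move/negP: nb1; apply; apply/bigcupP; exists st => //.
  by apply/setXP; split; [exact: agr|rewrite inE].
move/negP: nb2; apply; apply/bigcupP; exists st => //.
by apply/setXP; split; exact: agr.
Qed.

End RandomWords.

(** * Colourings by ordered pairs, twins as sequences *)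

Lemma exists_coloring n r (g : 'I_n -> 'I_n -> 'I_r) :
  exists c : coloring n r, forall x y : 'I_n, x < y -> color c x y = Some (g x y).
Proof.
have ex (e : pair2 n) : exists xy : 'I_n * 'I_n,
    (xy.1 < xy.2) && (val e == [set xy.1; xy.2]).
  case: e => e he /=; have /cards2P[x [y [ne ->]]] := he.
  case: (ltngtP x y) => [lt|lt|/ord_inj eq]; first by exists (x, y); rewrite lt /=.
    by exists (y, x); rewrite lt /= setUC.
  by rewrite eq eqxx in ne.
exists [ffun e => let xy := xchoose (ex e) in g xy.1 xy.2] => x y lt.
have ne : x != y by rewrite -(inj_eq val_inj) neq_ltn lt.
have [e he] := insub_pair2 ne; rewrite (color_pair2 _ he) ffunE.
have /andP[] := xchooseP (ex e); case: (xchoose _) => a b /= ltab.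
rewrite he => /eqP/setP eqs; congr (Some (g _ _)).
  have := eqs x; have := eqs y; have := eqs a; rewrite !inE !eqxx /= orbT.
  rewrite -!(inj_eq val_inj) /= => h1 h2 h3; apply: ord_inj; lia.
have := eqs x; have := eqs y; have := eqs b; rewrite !inE !eqxx /= orbT.
rewrite -!(inj_eq val_inj) /= => h1 h2 h3; apply: ord_inj; lia.
Qed.

(** A twin with l + 1 vertices on each side has l steps, which are all that is counted later. *)
Lemma twin_sequences n r (g : nat -> nat -> 'I_r) (c : coloring n r) l I J :
  (forall x y : 'I_n, x < y -> color c x y = Some (g x y)) ->
  is_twin c l.+1 I J -> exists u v : nat -> nat,
  [/\ forall t, t <= l -> u t < n /\ v t < n,
      forall s t, s < t <= l -> u s < u t /\ v s < v t,
      forall t, t <= l -> u t <> v t &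
      forall t, t < l -> g (u t) (u t.+1) = g (v t) (v t.+1)].
Proof.
move=> hc /and4P[/eqP cI /eqP cJ dis /forallP col].
(* Past l, [inord] gives a default value, so u and v are meaningful only up to l. *)
pose o (K : {set 'I_n}) (cK : #|K| = l.+1) t : 'I_#|K| := cast_ord (esym cK) (inord t).
pose ev K cK t := enum_val (@o K cK t).
have evlt K cK s t : s < t <= l -> @ev K cK s < @ev K cK t.
  move=> /andP[st tl]; apply: enum_val_increasing; rewrite /= !inordK //.
  exact: ltnW (leq_ltn_trans st _).
exists (fun t => nat_of_ord (ev I cI t)), (fun t => nat_of_ord (ev J cJ t)).
split=> [t _|s t h|t _ e|t tl].
- by split; exact: ltn_ord.
- by split; exact: evlt.
- have := disjointFr dis (enum_valP (o I cI t)).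
  rewrite -/(ev I cI t) (ord_inj e) => /negP; apply; exact: enum_valP.
move: (col (o I cI t)) => /forallP/(_ (o I cI t.+1))/forallP/(_ (o J cJ t)).
move=> /forallP/(_ (o J cJ t.+1))/implyP; rewrite /= !inordK ?eqxx //; last exact: ltnW.
move=> /(_ isT)/eqP; rewrite -!/(ev _ _ _) !hc; last first.
- by apply: evlt; rewrite ltnS leqnn.
- by apply: evlt; rewrite ltnS leqnn.
by case.
Qed.

(** * Counting along lists *)

Lemma size_le_sum_count (T S : eqType) (r : S -> pred T) (W : seq T) (K : seq S) :
  (forall t, t \in W -> exists2 s, s \in K & r s t) ->
  size W <= \sum_(s <- K) count (r s) W.
Proof.
elim: W => [|t W IH] h; first by rewrite big1.
rewrite /= big_split /= -add1n leq_add ?IH // => [|x xW]; last first.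
  by apply: h; rewrite inE xW orbT.
have [s sK rst] := h t (mem_head _ _).
by rewrite (big_rem s) //= rst.
Qed.

Lemma size_le_inj (W : seq nat) (f : nat -> nat) a d : uniq W ->
  {in W &, injective f} -> (forall t, t \in W -> a <= f t < a + d) -> size W <= d.
Proof.
move=> uW inj h; rewrite -(size_map f) -(size_iota a d); apply: uniq_leq_size.
  by rewrite map_inj_in_uniq.
by move=> _ /mapP[t /h ht ->]; rewrite mem_iota.
Qed.

(** * Blocks labelled by the plane over F *)

Section Blocks.
Variable F : finFieldType.
Local Notation p := #|F|.

Definition elt (k : nat) : F := nth 0%R (enum F) k.

Lemma elt_inj k k' : k < p -> k' < p -> elt k = elt k' -> k = k'.
Proof.
by move=> kp kp' /eqP; rewrite nth_uniq -?cardE ?enum_uniq // => /eqP.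
Qed.

(** In base p, [xco] is the last digit of v, [cco] the one before it, and [block] the rest. *)
Definition block v := v %/ p %/ p.
Definition xco v : F := elt (v %% p).
Definition cco v : F := elt ((v %/ p) %% p).

Lemma p_gt1 : 1 < p. Proof. exact: finNzRing_gt1. Qed.

(* A block is read as F x F in lexicographic order of (cco, xco); for fixed
   (a, b), the label runs bijectively through F x F, sweeping successively the
   p curves y = c + a x^2 + b x. *)
Definition label (ab : F * F) v : F * F :=
  (xco v, cco v + ab.1 * xco v ^+ 2 + ab.2 * xco v)%R.

Lemma xco_inj v v' : v %/ p = v' %/ p -> xco v = xco v' -> v = v'.
Proof.
have p0 := ltnW p_gt1.
move=> e /elt_inj; rewrite !ltn_mod => /(_ p0 p0) h.
by rewrite (divn_eq v p) (divn_eq v' p) e h.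
Qed.

(** Equal abscissas make the terms in a and b cancel, so the curve indices agree too. *)
Lemma label_inj ab v v' : block v = block v' -> label ab v = label ab v' -> v = v'.
Proof.
have p0 := ltnW p_gt1.
rewrite /block => e [ex]; rewrite ex => /addIr/addIr/elt_inj; rewrite !ltn_mod.
move=> /(_ p0 p0) h; apply: xco_inj ex.
by rewrite (divn_eq (v %/ p) p) (divn_eq (v' %/ p) p) e h.
Qed.

Lemma block_bounds v : block v * p <= v %/ p < block v * p + p.
Proof.
by rewrite leq_divM -mulSnr -ltn_divLR ?leqnn // ltnW // p_gt1.
Qed.

(** * Length of a twin in the block colouring *)

Section Twin.
Variables (l : nat) (u v : nat -> nat).
Hypothesis u_lt : forall s t, s < t <= l -> u s < u t.
Hypothesis v_lt : forall s t, s < t <= l -> v s < v t.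

Let u_inj s t : s <= l -> t <= l -> u s = u t -> s = t.
Proof.
by move=> sl tl e; case: (ltngtP s t) => // h;
  [have := @u_lt s t | have := @u_lt t s]; rewrite h ?sl ?tl => /(_ isT); rewrite e ltnn.
Qed.

(* The number of positions with fixed indices (c, c') of curves of the two
   types ab <> ab' is at most the number of intersection points of the curves,
   hence at most 2, and a chain of pairs (c, c') is determined by c + c'. *)
Lemma size_label_eq ab ab' b b' (W : seq nat) : uniq W -> ab <> ab' ->
  (forall t, t \in W -> [/\ t <= l, block (u t) = b, block (v t) = b' &
     label ab (u t) = label ab' (v t)]) ->
  size W <= 4 * p.
Proof.
move=> uW ne hW; pose d t := u t %/ p + v t %/ p.
have hd t : t \in W -> d t \in iota (b * p + b' * p) (2 * p).
  move=> /hW[_ eb eb' _]; rewrite mem_iota /d.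
  by have := block_bounds (u t); have := block_bounds (v t); rewrite eb eb'; lia.
(* At most 2p values of the sum, each attained at most twice. *)
apply: leq_trans (@size_le_sum_count _ _ (fun s t => d t == s) W
  (iota (b * p + b' * p) (2 * p)) _) _.
  by move=> t /hd h; exists (d t).
apply: (@leq_trans (\sum_(s <- iota (b * p + b' * p) (2 * p)) 2)); last first.
  by rewrite big_const_seq count_predT size_iota iter_addn; lia.
apply: leq_sum => s _; rewrite -size_filter.
set V := filter _ _; have VW t : t \in V -> t \in W /\ d t = s.
  by rewrite mem_filter => /andP[/eqP].
have uV : uniq V by rewrite filter_uniq.
have [->//|[t0 t0V]] : V = [::] \/ exists t0, t0 \in V.
  by case: V {VW uV} => [|t V]; [left|right; exists t; rewrite mem_head].
have mono t t' : t \in V -> t' \in V -> t < t' ->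
    u t %/ p = u t' %/ p /\ v t %/ p = v t' %/ p.
  move=> /VW[tW dt] /VW[tW' dt'] lt; have [tl' _ _ _] := hW _ tW'.
  have hu : u t %/ p <= u t' %/ p by rewrite leq_div2r // ltnW // u_lt // lt.
  have hv : v t %/ p <= v t' %/ p by rewrite leq_div2r // ltnW // v_lt // lt.
  by move: dt dt'; rewrite /d; lia.
have cst t t' : t \in V -> t' \in V -> u t %/ p = u t' %/ p /\ v t %/ p = v t' %/ p.
  move=> tV tV'; case: (ltngtP t t') => [lt|lt|->//]; first exact: mono.
  by have [-> ->] := mono _ _ tV' tV lt.
have xinj : {in V &, injective (fun t => xco (u t))}.
  move=> t t' tV tV' ex; have [e1 _] := cst _ _ tV tV'.
  have [/hW[tl _ _ _] _] := VW _ tV; have [/hW[tl' _ _ _] _] := VW _ tV'.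
  by apply: u_inj => //; exact: xco_inj ex.
(* The roots of this difference are the abscissas where the two curves meet; it is nonzero since ab
   <> ab', and has degree at most 2. *)
pose q : {poly F} := Poly [:: (cco (u t0) - cco (v t0))%R; (ab.2 - ab'.2)%R; (ab.1 - ab'.1)%R].
have q0 : q != 0%R.
  apply/eqP => /polyP q0; apply: ne.
  have := q0 1%N; have := q0 2%N; rewrite !coef_Poly !coef0 /=.
  move=> /eqP; rewrite subr_eq0 => /eqP e1 /eqP; rewrite subr_eq0 => /eqP e2.
  by case: (ab) (ab') e1 e2 => a1 a2 [a1' a2'] /= -> ->.
rewrite -(size_map (fun t => xco (u t))) -ltnS.
apply: leq_trans (max_poly_roots q0 _ _) (size_Poly _); last first.
  by rewrite map_inj_in_uniq.
apply/allP => _ /mapP[t tV ->]; have [/hW[_ _ _ [ex ey]] _] := VW _ tV.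
have [e1 e2] := cst _ _ tV t0V.
rewrite rootE horner_Poly /= mul0r add0r; apply/eqP.
move: ey; rewrite -ex /cco e1 e2 => ey.
have -> : elt (u t0 %/ p %% p) =
    (elt (v t0 %/ p %% p) + ab'.1 * xco (u t) ^+ 2 + ab'.2 * xco (u t)
     - ab.2 * xco (u t) - ab.1 * xco (u t) ^+ 2)%R.
  by rewrite -ey addrK addrK.
ring.
Qed.

Variables (w1 w2 : nat -> F * F).

(** The boolean keeps inner and cross colours apart, so equal colours make both sequences cross
    together. *)
Definition edge x y : bool * (F * F) :=
  if block x == block y then (true, label (w2 (block x)) x) else (false, w1 (block x)).

Variables (N k1 k2 : nat).
Hypothesis u_N : forall t, t <= l -> block (u t) < N.
Hypothesis v_N : forall t, t <= l -> block (v t) < N.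
Hypothesis uv_neq : forall t, t <= l -> u t <> v t.
Hypothesis edge_eq : forall t, t < l -> edge (u t) (u t.+1) = edge (v t) (v t.+1).
Hypothesis words : forall (T : seq nat) (f g : nat -> nat),
    sorted ltn (map f T) -> sorted ltn (map g T) ->
    (forall t, t \in T -> [/\ f t < N, g t < N, f t <> g t & w1 (f t) = w1 (g t)]) ->
    size T < k1 /\
    ((forall t, t \in T -> w2 (f t) = w2 (g t)) -> size T < k2).

Let bu t := block (u t).
Let bv t := block (v t).
Let cross t := bu t != bu t.+1.

Lemma crossP t : t < l -> cross t -> bv t != bv t.+1 /\ w1 (bu t) = w1 (bv t).
Proof.
move=> /edge_eq; rewrite /edge /cross /bu /bv.
by case: eqP => // _; case: eqP => // _ [].
Qed.

Lemma crossPn t : t < l -> ~~ cross t ->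
  [/\ bu t = bu t.+1, bv t = bv t.+1 & label (w2 (bu t)) (u t) = label (w2 (bv t)) (v t)].
Proof.
move=> /edge_eq; rewrite /edge /cross /bu /bv negbK.
case: eqP => // e; case: eqP => // e' [h1 h2] _; split=> //.
exact: (congr2 pair h1 h2).
Qed.

Let leq_block x y : x <= y -> block x <= block y.
Proof. by move=> h; rewrite /block !leq_div2r. Qed.

(** Blocks never decrease along u, so a cross step leaves its block for good. *)
Lemma bu_cross_lt s t : s < t < l -> cross s -> bu s < bu t.
Proof.
move=> /andP[st tl]; rewrite /cross => ne.
have h1 : bu s <= bu s.+1 by apply/leq_block/ltnW/u_lt; lia.
have h2 : bu s.+1 <= bu t.
  by have [->//|ne'] := eqVneq s.+1 t; apply/leq_block/ltnW/u_lt; lia.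
lia.
Qed.

Lemma bv_cross_lt s t : s < t < l -> cross s -> bv s < bv t.
Proof.
move=> /andP[st tl] cs; have [ne _] := crossP (ltn_trans st tl) cs.
have h1 : bv s <= bv s.+1 by apply/leq_block/ltnW/v_lt; lia.
have h2 : bv s.+1 <= bv t.
  by have [->//|ne'] := eqVneq s.+1 t; apply/leq_block/ltnW/v_lt; lia.
lia.
Qed.

(** Cross steps out of distinct blocks repeat a letter of [w1], as [words] requires. P will select
    all of them, or those with equal labellings. *)
Lemma cross_count (P : pred nat) :
  let T := [seq t <- iota 0 l | cross t && (bu t != bv t) && P t] in
  size T < k1 /\ ((forall t, P t -> w2 (bu t) = w2 (bv t)) -> size T < k2).
Proof.
move=> T.
have TP t : t \in T -> [/\ t < l, cross t, bu t <> bv t & P t].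
  by rewrite mem_filter mem_iota add0n => /andP[/andP[/andP[-> /eqP ?] ->] /= ->].
have srt (f : nat -> nat) : (forall s t, s < t < l -> cross s -> f s < f t) ->
    sorted ltn (map f T).
  move=> hf; apply: (@homo_sorted_in _ _ [in T] f ltn ltn).
  - by move=> s t /TP[_ cs _ _] /TP[tl _ _ _] st; by apply: hf => //; apply/andP.
  - by apply/allP.
  - by apply: (sorted_filter ltn_trans); exact: iota_ltn_sorted.
have [h1 h2] : size T < k1 /\ ((forall t, t \in T -> w2 (bu t) = w2 (bv t)) -> size T < k2).
  apply: words; [exact/srt/bu_cross_lt|exact/srt/bv_cross_lt|].
  move=> t /TP[tl ct ne _]; split=> //; last by have [] := crossP tl ct.
    exact/u_N/ltnW.
  exact/v_N/ltnW.
by split=> // h; apply: h2 => t /TP[_ _ _ /h].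
Qed.

Let W := [seq t <- iota 0 l | ~~ cross t].
(** Each run is represented by the time that ends it: a cross step, or l for the last run. *)
Let K := l :: [seq t <- iota 0 l | cross t && (bu t != bv t)].

Lemma withinP t : t \in W -> t < l /\ ~~ cross t.
Proof. by rewrite mem_filter mem_iota add0n => /andP[]. Qed.

(* Until the next cross step (or the end l) both sequences stay in their
   current blocks. *)
Lemma within_cover t : t \in W -> exists2 s, s \in K & (bu s == bu t) && (bv s == bv t).
Proof.
move=> /withinP[tl ct].
have ne : bu t != bv t.
  apply/eqP => e; have [_ _ el] := crossPn tl ct.
  by apply: (uv_neq (ltnW tl)); rewrite e in el; apply: label_inj el.
move/ltnW: tl ne => tl ne; have [m] := ubnP (l - t).
elim: m t tl ne {ct} => // m IH t tl ne hm.
have [->|tnl] := eqVneq t l; first by exists l; rewrite ?mem_head ?eqxx.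
have {tnl}tl : t < l by rewrite ltn_neqAle tnl.
have [ct|nct] := boolP (cross t).
  by exists t; rewrite ?eqxx // inE mem_filter mem_iota ct ne tl orbT.
have [-> -> _] := crossPn tl nct.
apply: IH => //; last lia.
by have [<- <- _] := crossPn tl nct.
Qed.

Lemma within_fiber s : count (fun t => (bu s == bu t) && (bv s == bv t)) W <=
  4 * p + (w2 (bu s) == w2 (bv s)) * p ^ 2.
Proof.
rewrite -size_filter; set V := filter _ _.
have VP t : t \in V -> [/\ t < l, ~~ cross t, bu t = bu s & bv t = bv s].
  by rewrite mem_filter => /andP[/andP[/eqP-> /eqP->] /withinP[]].
have uV : uniq V by rewrite !filter_uniq ?iota_uniq.
case: eqP => [_|ne].
  (* With equal labellings the bound is just the number of vertices of a block. *)
  apply: leq_trans (leq_addl _ _); rewrite mul1n.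
  apply: (@size_le_inj _ u (bu s * p ^ 2)) => // [t t' /VP[tl _ _ _] /VP[tl' _ _ _]|t].
    by apply: u_inj; exact: ltnW.
  move=> /VP[_ _ <- _]; rewrite /bu /block -divnMA mulnn.
  by rewrite leq_divM -mulSnr -ltn_divLR ?leqnn // expn_gt0 ltnW ?p_gt1.
rewrite addn0; apply: (size_label_eq uV ne) => t /VP[tl ct e e'].
by split; [exact: ltnW|exact: e|exact: e'|rewrite -e -e'; have [] := crossPn tl ct].
Qed.

Lemma twin_length : l <= N + (4 * p * k1 + p ^ 2 * k2).
Proof.
have -> : l = count cross (iota 0 l) + count (predC cross) (iota 0 l).
  by rewrite count_predC size_iota.
apply: leq_add.
  rewrite -size_filter; apply: (@size_le_inj _ bu 0) => [|s t|t].
  - by rewrite filter_uniq ?iota_uniq.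
  - rewrite !mem_filter !mem_iota !add0n => /andP[cs sl] /andP[ct tl] e.
    by case: (ltngtP s t) => // lt; [have := @bu_cross_lt s t | have := @bu_cross_lt t s];
      rewrite lt e ltnn /= => h; exfalso; apply: (notF (h _ _)).
  - by rewrite mem_filter mem_iota add0n => /andP[_ /ltnW/u_N].
rewrite -size_filter; apply: leq_trans (size_le_sum_count within_cover) _.
apply: leq_trans (leq_sum _ (fun s _ => within_fiber s)) _.
have -> : \sum_(s <- K) (4 * p + (w2 (bu s) == w2 (bv s)) * p ^ 2) =
    4 * p * size K + p ^ 2 * count (fun s => w2 (bu s) == w2 (bv s)) K.
  elim: (K) => [|s S IH]; first by rewrite big_nil !muln0.
  by rewrite big_cons IH /=; lia.
apply: leq_add; rewrite leq_mul2l; apply/orP; right.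
  (* The strict bound leaves room for the extra entry l of [K]. *)
  have [h _] := cross_count predT; apply: leq_trans h; rewrite /= ltnS.
  by under [in leqRHS]eq_filter do rewrite andbT.
have [_ h] := cross_count (fun s => w2 (bu s) == w2 (bv s)).
apply: leq_trans (h _) => [|t /eqP//]; rewrite /= -add1n leq_add ?leq_b1 //.
by rewrite -size_filter -filter_predI; under eq_filter do rewrite /= andbC.
Qed.

End Twin.
End Blocks.

(** * Choice of parameters and of the field *)

Lemma min_max_twin_le_n r n : 0 < r -> min_max_twin r n <= n.
Proof.
move=> r0; have [[c <-] _] := min_max_twinP n r0.
by apply/bigmax_leqP => i _; rewrite -ltnS.
Qed.

Lemma min_max_twin_le (F : finFieldType) r n : 2 * #|F| ^ 2 <= r ->
  min_max_twin r n <= 41 * (n %/ #|F| ^ 2).+1 + 4 * #|F| + #|F| ^ 2 + 1.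
Proof.
move=> hr; set N := (_ %/ _).+1; set p := #|F|.
have p1 : 1 < p := finNzRing_gt1 F.
(* The least values with p k1 > 8N and p^2 k2 > 8N. Then 4 p k1 <= 32N + 4p and p^2 k2 <= 8N + p^2,
   whence 41 = 1 + 32 + 8. *)
pose k1 := (8 * N %/ p).+1; pose k2 := (8 * N %/ p ^ 2).+1.
have cA : #|{: F * F}| = p ^ 2 by rewrite card_prod mulnn.
have p20 : 0 < p ^ 2 by rewrite expn_gt0 ltnW.
have [|||w1 [w2 hw]] := @exists_words (F * F)%type N k1 k2.
- by rewrite cA.
- by rewrite cA bin_sqr_lt // ltnW // ltn_ceil // ltnW.
- by rewrite cA bin_sqr_lt // ltnW // ltn_ceil.
have hcard : #|{: bool * (F * F)}| <= r by rewrite card_prod card_bool cA.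
pose enc x := widen_ord hcard (enum_rank x).
have enc_inj : injective enc.
  by move=> x y /(congr1 val) /= /ord_inj/enum_rank_inj.
pose g x y := enc (edge w1 w2 x y).
have [c hc] := exists_coloring (fun x y : 'I_n => g x y).
have r0 : 0 < r by apply: leq_trans hr; rewrite muln_gt0.
apply: leq_trans (proj2 (min_max_twinP n r0) c) _.
apply/bigmax_leqP => -[[|l] /= _] //.
case/existsP => I /existsP[J /(twin_sequences hc)].
move=> [u [v [uv_n uv_lt uv_ne uv_g]]].
have blk x : x < n -> block F x < N.
  by move=> xn; rewrite /block -divnMA mulnn ltnS leq_div2r // ltnW.
have h : l <= N + (4 * p * k1 + p ^ 2 * k2).
  apply: (@twin_length F l u v _ _ w1 w2 N k1 k2 _ _ _ _ hw).
  - by move=> s t /uv_lt[].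
  - by move=> s t /uv_lt[].
  - by move=> t /uv_n[/blk].
  - by move=> t /uv_n[_ /blk].
  - exact: uv_ne.
  - by move=> t /uv_g/enc_inj.
move: h (leq_divM (8 * N) p) (leq_divM (8 * N) (p ^ 2)).
rewrite /k1 /k2; move: (_ %/ p) (_ %/ p ^ 2) => a b.
by move: (N) (p ^ 2) => M p2; nia.
Qed.

Lemma mul_min_max_twin_le r n : 0 < r -> 5 * r ^ 2 <= n ->
  r * min_max_twin r n <= 400 * n.
Proof.
move=> r0 hn; have [r8|r8] := ltnP r 8.
  by have := min_max_twin_le_n n r0; nia.
have h2 : 0 < r./2 by lia.
(* Since 4^k <= r./2 < 4^(k+1), the field with 2^k elements satisfies 2p^2 <= r < 8p^2; r >= 8
   ensures k > 0. *)
pose k := trunc_log 4 r./2.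
have /andP[kr rk] := trunc_log_bounds (isT : 1 < 4) h2.
have k0 : 0 < k.
  by rewrite lt0n; apply/eqP => k0; move: rk; rewrite -/k k0; lia.
have [F _ cF] := pPrimePowerField (isT : prime 2) k0.
have cF2 : #|F| ^ 2 = 4 ^ k by rewrite cF -expnM mulnC expnM.
have pr : 2 * #|F| ^ 2 <= r by rewrite cF2 -/k in kr *; lia.
have rp : r < 8 * #|F| ^ 2 by rewrite cF2; move: rk; rewrite -/k expnS; lia.
have := min_max_twin_le n pr.
have := leq_divM n (#|F| ^ 2).
have : #|F| <= #|F| ^ 2 by rewrite -mulnn leq_pmulr // ltnW // finNzRing_gt1.
move: hn; rewrite -(mulnn r); move: pr rp; set m := #|F| ^ 2; set p := #|F|.
(* The main term is 41 r d <= 328 n; the rest is at most 47 r^2, absorbed by n >= 5 r^2. *)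
move: (n %/ m) (min_max_twin r n) => d M pr rp hn pm dm hM.
have h3 : r * d <= 8 * n by nia.
have h4 : r * M <= r * (41 * d.+1 + 4 * p + m + 1) by rewrite leq_mul2l hM orbT.
have h5 : r * (41 + 4 * p + m + 1) <= r * (47 * r) by rewrite leq_mul2l; lia.
nia.
Qed.

Local Open Scope ring_scope.

Theorem theorem3 (R : realType) :
  exists C : R, 0 < C /\
    forall r : nat, (0 < r)%N ->
      exists n0 : nat, forall n : nat, (n0 <= n)%N ->
        (min_max_twin r n)%:R <= C * n%:R / r%:R.
Proof.
exists 400%:R; split=> [|r r0]; first by rewrite ltr0n.
exists (5 * r ^ 2)%N => n hn.
rewrite ler_pdivlMr ?ltr0n // -!natrM ler_nat mulnC.
exact: mul_min_max_twin_le.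
Qed.
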